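(* For every integer $n\geq 0$ and any indeterminate $y$, \[ \sum_{k=0}^{n}(-1)^{n-k}\binom{n}{k}L_{n,k}(y+1)^{k}=\sum_{k=0}^{n}\binom{n}{k}(k+1)^{k-1}y^{k}, \qquad \sum_{k=0}^{n}\binom{n}{k}L_{n,k}\,y^{k} = \sum_{k=0}^{n}(-1)^{n-k}\binom{n}{k}(k+1)^{k-1}(y+1)^{k}. \]
   Context: A labeled forest on a finite set $S$ is a set of rooted trees whose vertex sets partition $S$; a singleton tree is a tree with exactly one vertex. For $0\le k\le n$, $L_{n,k}$ is the number of labeled forests on $[n+1]=\{1,\dots,n+1\}$ in which $\{k+1\}$ is a singleton tree and no $i>k+1$ forms a singleton tree. $(0+1)^{-1}=1$. *)

(* Defs.v *)
From mathcomp Require Import all_boot all_order all_algebra.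

Set Implicit Arguments.
Unset Strict Implicit.
Unset Printing Implicit Defensive.

(* Triples (vertex set, edge set, root). *)
Notation rooted_graph T := ({set T} * {set {set T}} * T)%type.

Section Forests.

Variable T : finType.

(* The graph (V, E) has its edges encoded as two-element subsets of V. *)
Definition simple_graph (V : {set T}) (E : {set {set T}}) : bool :=
  [forall e in E, (e \subset V) && (#|e| == 2)].

Definition adj (E : {set {set T}}) : rel T := fun x y => [set x; y] \in E.

Definition connected_graph (V : {set T}) (E : {set {set T}}) : bool :=
  [forall x in V, forall y in V, connect (adj E) x y].

(* Bounding the length by #|T| loses no cycle: cycles are duplicate-free. For
   a simple graph, [ucycleb] of length 2 only means an edge, hence [m <= 2]. *)
Definition acyclic_graph (E : {set {set T}}) : bool :=
  [forall m : 'I_#|T|.+1, forall c : m.-tuple T, ucycleb (adj E) c ==> (m <= 2)].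

Definition is_tree (V : {set T}) (E : {set {set T}}) : bool :=
  [&& V != set0, simple_graph V E, connected_graph V E & acyclic_graph E].

Definition vertices (t : rooted_graph T) : {set T} := t.1.1.
Definition edges (t : rooted_graph T) : {set {set T}} := t.1.2.
Definition root_of (t : rooted_graph T) : T := t.2.

Definition is_rooted_tree (t : rooted_graph T) : bool :=
  is_tree (vertices t) (edges t) && (root_of t \in vertices t).

(* Injectivity of [vertices] on F is needed because the image set would
   otherwise identify two different trees on the same vertex set. *)
Definition is_labeled_forest (S : {set T}) (F : {set rooted_graph T}) : bool :=
  [&& [forall t in F, is_rooted_tree t],
      dinjectiveb vertices (mem F) &
      partition [set vertices t | t in F] S].

Definition is_singleton_tree_of (F : {set rooted_graph T}) (i : T) : bool :=
  [exists t in F, vertices t == [set i]].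

End Forests.

(* The label set {1, ..., n+1} is represented by 'I_n.+1 = {0, ..., n}: the
   element i stands for the label i + 1, so that k stands for k + 1. *)
Definition L (n : nat) (k : 'I_n.+1) : nat :=
  #|[set F : {set rooted_graph 'I_n.+1} |
      [&& is_labeled_forest [set: 'I_n.+1] F,
          is_singleton_tree_of F k &
          [forall i : 'I_n.+1, (k < i) ==> ~~ is_singleton_tree_of F i]]]|.

(* (k+1)^(k-1); the truncated predecessor gives 1 ^ 0 = 1 at k = 0, which
   agrees with (0+1)^(-1) = 1. *)
Definition tree_coef (k : nat) : nat := k.+1 ^ k.-1.

(* Main.v *)
(** A rooted forest is the same thing as a parent map, i.e. a self-map all of
    whose orbits end in a fixed point. Forests with [r] prescribed roots and [m]
    other vertices number [r (m + r)^(m - 1)]: removing the roots and promoting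
    their children to roots gives a recursion on [m], solved by the binomial
    theorem. Summing over the root sets gives Cayley's count [tree_coef n] of
    the forests on [n] vertices. Inclusion-exclusion over the singleton trees
    then gives
      [L_{n,k} = sum_j (-1)^j C(n-k, j) tree_coef (n-j)],
    from which the second identity follows by the binomial theorem, with any
    [z] in place of [y]; the first one is the case [z = -(y+1)]. *)

Require Import Defs.
From mathcomp Require Import all_boot all_order all_algebra.
From mathcomp Require Import zify ring.
Import GRing.Theory.

Set Implicit Arguments.
Unset Strict Implicit.
Unset Printing Implicit Defensive.

(** * Forests with prescribed roots: the recursion *)

(* The number of forests on [m + r] vertices with [r] prescribed roots. *)
Definition rooted_forests (m r : nat) : nat :=
  if m is m'.+1 then r * (m + r) ^ m' else 1.

(** Here [j] counts the children of the roots, which become the roots of what remains. After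
    multiplication by [m + 1], the absorption rule [(i+1) C(m+1, i+1) = (m+1) C(m, i)] turns the sum
    into the binomial expansion of [(m+1) r (m+1+r)^m]. *)
Lemma rooted_forests_rec (m r : nat) :
  \sum_(j < m.+2) 'C(m.+1, j) * (r ^ j * rooted_forests (m.+1 - j) j)
  = rooted_forests m.+1 r.
Proof.
rewrite big_ord_recl /= mul0n !muln0 add0n.
apply/eqP; rewrite -(eqn_pmul2l (ltn0Sn m)) big_distrr /=; apply/eqP.
rewrite expnDn mulnA big_distrr /=; apply: eq_bigr => i _.
rewrite /bump /= add1n subSS.
have key : m.+1 * rooted_forests (m - i) i.+1 = i.+1 * m.+1 ^ (m - i).
  have := ltn_ord i; case E: (m - i) => [|d] /= lt_i_m; first by lia.
  by rewrite (_ : d.+1 + i.+1 = m.+1) ?expnS; [nia | lia].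
transitivity ('C(m.+1, i.+1) * r ^ i.+1 * (m.+1 * rooted_forests (m - i) i.+1)).
  by ring.
have := mul_bin_diag m.+1 i; rewrite key expnS [m.+1.-1]/= => E.
transitivity ((i.+1 * 'C(m.+1, i.+1)) * (r * r ^ i * m.+1 ^ (m - i))); first by ring.
rewrite -E; ring.
Qed.

Lemma sum_subset_card (T : finType) (U : {set T}) (F : nat -> nat) :
  \sum_(J : {set T} | J \subset U) F #|J| = \sum_(j < #|U|.+1) 'C(#|U|, j) * F j.
Proof.
rewrite (partition_big (fun J : {set T} => inord #|J| : 'I_#|U|.+1) xpredT) //=.
apply: eq_bigr => j _; rewrite -cards_draws -sum_nat_const.
apply: congr_big => // [J|J].
  rewrite inE; case: (boolP (J \subset U)) => //= /subset_leq_card le_JU.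
  by rewrite -val_eqE /= inordK.
case/andP=> /subset_leq_card le_JU /eqP <-.
by rewrite inordK.
Qed.

(** * Counting parent maps *)

Section ParentMaps.

Variable T : finType.
Implicit Types (p q : {ffun T -> T}) (x y : T) (U R S J : {set T}).

(* Roots are their own parents. *)
Definition parent_map p := [forall x, exists y, fconnect p x y && (p y == y)].

Lemma parent_mapP p :
  reflect (forall x, exists n, p (iter n p x) = iter n p x) (parent_map p).
Proof.
apply: (iffP forallP) => H x.
  have /existsP[y /andP[/iter_findex <- /eqP py]] := H x.
  by exists (findex p x y).
have [n pn] := H x; apply/existsP; exists (iter n p x).
by rewrite fconnect_iter pn eqxx.
Qed.

(** For disjoint [U] and [R] these encode the forests on [U :|: R] with root set [R]. Points outside
    [U] are fixed, so that a map is determined by its forest. *)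
Definition attachments U R : {set {ffun T -> T}} :=
  [set p | [&& parent_map p, [forall x, (p x == x) == (x \notin U)]
             & [forall x in U, p x \in U :|: R]]].

Lemma attachmentsP U R p :
  reflect [/\ parent_map p, forall x, (p x == x) = (x \notin U)
            & forall x, x \in U -> p x \in U :|: R]
          (p \in attachments U R).
Proof.
rewrite inE; apply: (iffP and3P) => [[? /forallP H1 /forall_inP ?]|[? H1 ?]].
  by split=> // x; rewrite (eqP (H1 x)).
by split; [|apply/forallP => x; rewrite H1|apply/forall_inP].
Qed.

(** Orbits of [p] and [q] agree until they meet [J]; there [q] stops at once and [p] one step
    later. *)
Lemma parent_map_cut p q J :
    (forall x, x \in J -> q x = x) -> (forall x, x \notin J -> q x = p x) ->
    (forall x, x \in J -> p (p x) = p x) ->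
  parent_map p = parent_map q.
Proof.
move=> qJ qN pJ; apply/parent_mapP/parent_mapP => H x; have [n] := H x;
  elim: n x {H} => [|n IHn] x.
- by case: (boolP (x \in J)) => xJ px; exists 0; [exact: qJ | rewrite /= qN].
- rewrite iterSr => /IHn[m qm].
  case: (boolP (x \in J)) => xJ; first by exists 0; rewrite /= qJ.
  by exists m.+1; rewrite iterSr (qN x).
- case: (boolP (x \in J)) => xJ; first by exists 1; rewrite /= (pJ x).
  by rewrite /= (qN x) // => px; exists 0.
case: (boolP (x \in J)) => xJ; first by exists 1; rewrite /= (pJ x).
by rewrite iterSr (qN x) // => /IHn[m pm]; exists m.+1; rewrite iterSr.
Qed.

(** Functions from [J] to [R], made total by the identity outside [J]. *)
Definition maps_from_to J R : {set {ffun T -> T}} :=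
  [set g : {ffun T -> T} | [forall x, if x \in J then g x \in R else g x == x]].

Lemma card_maps_from_to J R : #|maps_from_to J R| = #|R| ^ #|J|.
Proof.
pose F x := if x \in J then mem R else mem (pred1 x).
have -> : #|maps_from_to J R| = #|family F|.
  apply: eq_card => g; rewrite inE; apply/forallP/familyP => H x;
  by have := H x; rewrite /F; case: (x \in J).
rewrite card_family foldrE big_map big_enum /=.
rewrite (bigID (mem J)) /= [X in _ * X]big1 ?muln1; last first.
  by move=> x /negbTE xJ; rewrite /F xJ card1.
rewrite (eq_bigr (fun=> #|R|)) ?prod_nat_const // => x xJ.
by rewrite /F xJ.
Qed.

(** [J] is the layer of children of the roots. A forest with this layer amounts to a free choice of
    a parent in [R] for each point of [J], together with a forest on [U] whose root set is [J]. *)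
Lemma card_attachments_layer U R J :
    [disjoint U & R] -> J \subset U ->
  #|[set p in attachments U R | [set x in U | p x \in R] == J]|
  = #|R| ^ #|J| * #|attachments (U :\: J) J|.
Proof.
move=> dUR sJU.
have RU x : x \in R -> x \notin U by apply: contraL => /(disjointFr dUR) ->.
rewrite -card_maps_from_to -cardsX.
pose f (gq : {ffun T -> T} * {ffun T -> T}) : {ffun T -> T} :=
  [ffun x => if x \in J then gq.1 x else gq.2 x].
(* The gluing [f] loses nothing: [g] is the identity off [J], and [q] is the identity on [J]. *)
rewrite -(card_in_imset (f := f)); last first.
  move=> [g q] [g' q']; rewrite !inE /= => /andP[/forallP gP qP] /andP[/forallP g'P q'P].
  have /attachmentsP[_ qU _] : q \in attachments (U :\: J) J by rewrite inE.
  have /attachmentsP[_ q'U _] : q' \in attachments (U :\: J) J by rewrite inE.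
  move=> /ffunP Ef; congr pair; apply/ffunP => x; have := Ef x; have := gP x;
    have := g'P x; rewrite !ffunE /=; case: (boolP (x \in J)) => xJ //.
    by move=> /eqP-> /eqP->.
  move=> _ _ _; have := qU x; have := q'U x.
  by rewrite !inE xJ /= => /eqP -> /eqP ->.
apply: eq_card => p; apply/idP/imsetP => [|[[g q]]].
  rewrite inE => /andP[/attachmentsP[pm pU pR] /eqP EJ].
  have JE x : (x \in J) = (x \in U) && (p x \in R) by rewrite -EJ inE.
  exists ([ffun x => if x \in J then p x else x], [ffun x => if x \in J then x else p x]).
    rewrite inE /=; apply/andP; split.
      rewrite inE; apply/forallP => x; rewrite ffunE.
      by have := JE x; case: (x \in J) => // /esym/andP[].
    apply/attachmentsP; split.
    - rewrite -(@parent_map_cut p _ J) // => x xJ; rewrite ?ffunE ?xJ ?(negbTE xJ) //.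
      by apply/eqP; rewrite pU RU //; move: xJ; rewrite JE => /andP[].
    - by move=> x; rewrite ffunE inE; case: ifP; rewrite ?eqxx ?pU.
    move=> x; rewrite inE ffunE => /andP[/negbTE xJ xU]; rewrite xJ.
    have := pR x xU; rewrite !inE; have := JE x; rewrite xJ xU /= => <-.
    by rewrite orbF => ->; rewrite andbT orNb.
  by apply/ffunP => x; rewrite !ffunE /=; case: (x \in J).
case/setXP => gP /attachmentsP[qm qU qR] ->.
have {}gP : forall x, if x \in J then g x \in R else g x == x.
  by apply/forallP; move: gP; rewrite inE.
have gR x : x \in J -> g x \in R by move=> xJ; have := gP x; rewrite xJ.
have qUJ x : x \in U -> x \notin J -> q x \in U.
  move=> xU xJ; have := qR x; rewrite !inE xU xJ => /(_ isT).
  by case/orP=> [/andP[]|/(subsetP sJU)].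
have qRid x : x \notin U -> q x = x.
  by move=> xU; apply/eqP; rewrite qU inE (negbTE xU) andbF.
(* The glued map has layer exactly [J], because off [J] the map [q] keeps [U] inside [U], which is
   disjoint from [R]. *)
rewrite inE; apply/andP; split; last first.
  apply/eqP/setP => x; rewrite inE /f ffunE /=.
  case: (boolP (x \in J)) => xJ; first by rewrite gR // (subsetP sJU).
  by apply/negP => /andP[xU]; move/RU; rewrite qUJ.
have fJ x : x \in J -> f (g, q) x = g x by move=> xJ; rewrite ffunE xJ.
have fN x : x \notin J -> f (g, q) x = q x by move=> /negbTE xJ; rewrite ffunE xJ.
have JU x : x \in J -> x \in U by apply: subsetP.
apply/attachmentsP; split.
- rewrite (@parent_map_cut _ q J) // => x xJ; first by apply/eqP; rewrite qU !inE xJ.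
    by rewrite fN.
  have gxU := RU _ (gR x xJ).
  by rewrite (fJ x) // fN ?qRid //; apply: contra gxU; apply: JU.
- move=> x; case: (boolP (x \in J)) => xJ; last by rewrite fN // qU !inE xJ.
  rewrite fJ // (JU x xJ); apply/eqP => gx.
  by have := RU _ (gR x xJ); rewrite gx JU.
move=> x xU; rewrite inE; case: (boolP (x \in J)) => xJ.
  by rewrite fJ // gR ?orbT.
by rewrite fN // qUJ.
Qed.

(** Without roots, an orbit starting in [U] stays in [U], where no point is fixed. *)
Lemma attachments0 U : U != set0 -> attachments U set0 = set0.
Proof.
case/set0Pn => x xU; apply/setP => p; rewrite in_set0; apply/negP.
case/attachmentsP => /parent_mapP/(_ x)[n pn] pU pR.
have itU m : iter m p x \in U.
  by elim: m => //= m IHm; have := pR _ IHm; rewrite setU0.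
by have := pU (iter n p x); rewrite pn eqxx itU.
Qed.

(** Strong induction on [#|U|]: sorting the maps by the layer [J] of children of the roots
    reproduces the sum of [rooted_forests_rec]. *)
Lemma card_attachments U R :
  [disjoint U & R] -> #|attachments U R| = rooted_forests #|U| #|R|.
Proof.
have [m] := ubnP #|U|; elim: m => // m IHm in U R * => /ltnSE le_U dUR.
have [->|U0] := eqVneq U set0.
  rewrite cards0 /=; apply/eqP/cards1P; exists [ffun x => x]; apply/setP => p.
  rewrite inE; apply/attachmentsP/eqP => [[_ pU _]|->].
    by apply/ffunP => x; rewrite ffunE; apply/eqP; rewrite pU inE.
  split=> [|x|x]; rewrite ?ffunE ?inE ?eqxx //.
  by apply/parent_mapP => x; exists 0; rewrite /= ffunE.
rewrite -sum1_card (partition_big (fun p => [set x in U | p x \in R])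
  (fun J => J \subset U)) /=; last first.
  by move=> p _; apply/subsetP => x; rewrite inE => /andP[].
case def_m : #|U| => [|u]; first by move: U0; rewrite -card_gt0 def_m.
rewrite -rooted_forests_rec -def_m.
rewrite -(sum_subset_card U (fun j => #|R| ^ j * rooted_forests (#|U| - j) j)).
apply: eq_bigr => J sJU.
rewrite sum1dep_card.
have -> : #|[set p | (p \in attachments U R) & ([set x in U | p x \in R] == J)]|
  = #|[set p in attachments U R | [set x in U | p x \in R] == J]| by [].
rewrite card_attachments_layer //.
have cU := cardsD U J; rewrite (setIidPr sJU) in cU.
(* For empty [J] the set [U :\: J] is not smaller than [U], so the induction hypothesis does not
   apply; both sides vanish. *)
have [->|J0] := eqVneq J set0.
  by rewrite cards0 setD0 subn0 attachments0 // cards0 def_m /= mul0n !muln0.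
rewrite IHm ?cU //; last by rewrite -setI_eq0 setIDAC -setIDA setDv setI0.
apply: leq_trans le_U; rewrite ltn_subrL card_gt0 J0 /=.
by rewrite card_gt0.
Qed.

Definition parent_maps_on S : {set {ffun T -> T}} :=
  [set p | parent_map p && [forall x, if x \in S then p x \in S else p x == x]].

(** Joining all roots to one extra vertex makes that vertex the only prescribed root, whence
    [rooted_forests #|S| 1]. The sum over root sets [R] is its recursion, with trivial factors
    [1 ^ j]. *)
Lemma card_parent_maps_on S : #|parent_maps_on S| = tree_coef #|S|.
Proof.
have -> : tree_coef #|S| = rooted_forests #|S| 1.
  by rewrite /tree_coef; case: #|S| => //= m; rewrite mul1n addn1.
rewrite -sum1_card (partition_big (fun p => [set x in S | p x == x])
  (fun R => R \subset S)) /=; last first.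
  by move=> p _; apply/subsetP => x; rewrite inE => /andP[].
transitivity (\sum_(R : {set T} | R \subset S) rooted_forests (#|S| - #|R|) #|R|).
  apply: eq_bigr => R sRS; rewrite sum1dep_card.
  have <- : #|S :\: R| = #|S| - #|R| by rewrite cardsD (setIidPr sRS).
  rewrite -card_attachments; last by rewrite -setI_eq0 setIDAC -setIDA setDv setI0.
  apply: eq_card => p; rewrite !inE; apply/andP/and3P.
    move=> [/andP[pm /forallP pS] /eqP ER].
    have RE x : (x \in R) = (x \in S) && (p x == x) by rewrite -ER inE.
    split=> //; first (apply/forallP => x; have := pS x; rewrite !inE RE).
      by case: (x \in S) => /= [_|/eqP ->]; rewrite ?eqxx // andbT negbK.
    apply/forall_inP => x; have := pS x; rewrite !inE RE => H /andP[_ xS].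
    by move: H; rewrite xS => ->; rewrite orbC andbT orbN.
  move=> [-> /forallP pU /forall_inP pR].
  have RS x : x \in R -> x \in S by apply: subsetP.
  have {}pU x : (p x == x) = (x \notin S :\: R) := eqP (pU x).
  split=> /=.
    apply/forallP => x; case: ifP => xS; last by rewrite pU inE xS andbF.
    case: (boolP (x \in R)) => xR.
      by have := pU x; rewrite inE xR => /eqP ->.
    by have := pR x; rewrite !inE xS xR => /(_ isT)/orP[/andP[]|/RS].
  apply/eqP/setP => x; rewrite inE pU inE negb_and negbK.
  by case: (boolP (x \in R)) => [/RS ->|] //=; case: (x \in S).
(* The recursion is stated for a successor, so empty [S] is treated apart. *)
have [S0|[m ES]] : #|S| = 0 \/ exists m, #|S| = m.+1.
- by case: #|S| => [|m]; [left|right; exists m].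
- rewrite S0; have -> := cards0_eq S0; rewrite (big_pred1 set0) ?cards0 // => R.
  by rewrite subset0.
rewrite ES -rooted_forests_rec -ES.
rewrite (sum_subset_card S (fun r => rooted_forests (#|S| - r) r)).
by apply: eq_bigr => j _; rewrite exp1n mul1n.
Qed.

End ParentMaps.

(** * Bijection between parent maps and labeled forests *)

Section ForestsOfParentMaps.

Variable T : finType.
Implicit Types (p q : {ffun T -> T}) (x y r : T).
Implicit Types (E : {set {set T}}) (t : rooted_graph T) (F : {set rooted_graph T}).

Lemma fconnect_fixed p r y : p r = r -> fconnect p r y -> y = r.
Proof. by move=> pr /iter_findex <-; exact: iter_fix. Qed.

Lemma fconnect_root_unique p x r s :
  p r = r -> p s = s -> fconnect p x r -> fconnect p x s -> r = s.
Proof.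
move=> pr ps /iter_findex; set n := findex _ _ _ => xr.
move=> /iter_findex; set m := findex _ _ _ => xs.
by rewrite -(iter_fix m pr) -xr -iterD addnC iterD xs iter_fix.
Qed.

Lemma fconnect_to_fixed p x r : p r = r -> fconnect p (p x) r = fconnect p x r.
Proof.
move=> pr; apply/idP/idP; first exact: connect_trans (fconnect1 p x).
by move/iter_findex => xr; rewrite -pr -xr -iterS iterSr fconnect_iter.
Qed.

Lemma parent_map_root p x :
  parent_map p -> exists2 r, p r = r & fconnect p x r.
Proof.
by move/parent_mapP/(_ x) => [n pn]; exists (iter n p x); rewrite ?fconnect_iter.
Qed.

(** On a cycle of length [k + 1], taking [n (k + 1)] steps leads back to [x]. The orbit is
    stationary from step [n] on, so [x] is its fixed point. *)
Lemma parent_map_acyclic p x : parent_map p -> fconnect p (p x) x -> p x = x.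
Proof.
move/parent_mapP/(_ x) => [n pn] /iter_findex; set k := findex _ _ _.
rewrite -iterSr => xx.
have itx m : iter (m * k.+1) p x = x by rewrite iterM; elim: m => //= m ->.
have : iter (n * k) p (iter n p x) = x by rewrite -iterD addnC -mulnS itx.
by rewrite (iter_fix _ pn) => <-.
Qed.

(** [order p x], the size of the orbit of [x], serves as the depth of [x]. By acyclicity the orbit
    of [p x] misses [x]. *)
Lemma order_parent p x : parent_map p -> p x != x -> order p (p x) < order p x.
Proof.
move=> pm px; apply/proper_card/properP; split.
  by apply/subsetP => y; apply: connect_trans; apply: fconnect1.
exists x; first exact: connect0.
by apply: contra px => /(parent_map_acyclic pm)/eqP.
Qed.

Definition tree_at p r : rooted_graph T :=
  ([set x | fconnect p x r],
   [set [set x; p x] | x in [set x | fconnect p x r] :\ r], r).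

Definition forest_of p : {set rooted_graph T} :=
  [set tree_at p r | r in [set r | p r == r]].

Lemma adj_sym E : symmetric (adj E).
Proof. by move=> x y; rewrite /adj setUC. Qed.

Lemma set2_eq x y z w :
  [set x; y] = [set z; w] -> (x = z /\ y = w) \/ (x = w /\ y = z).
Proof.
move=> /setP E; have := E x; have := E y; have := E z; have := E w.
rewrite !inE !eqxx !(orbT, orTb).
by do 4 ![move=> /esym/orP[]/eqP ? | move=> /orP[]/eqP ?]; subst; auto.
Qed.

Lemma adj_tree_at p r x y :
  adj (edges (tree_at p r)) x y -> p x = y \/ p y = x.
Proof.
by case/imsetP => z _ /set2_eq[[-> ->]|[-> ->]]; [left|right].
Qed.

Lemma connect_tree_at p r x :
  fconnect p x r -> connect (adj (edges (tree_at p r))) x r.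
Proof.
move/iter_findex; move: (findex p x r) => n; elim: n x => [x /= ->|n IHn x] //.
rewrite iterSr => xr; have [->|x_r] := eqVneq x r; first exact: connect0.
apply: connect_trans (IHn _ xr); apply: connect1; apply/imsetP; exists x => //.
by rewrite !inE x_r -xr -iterSr fconnect_iter.
Qed.

Lemma connected_tree_at p r :
  connected_graph (vertices (tree_at p r)) (edges (tree_at p r)).
Proof.
apply/forall_inP => x; rewrite inE => xr; apply/forall_inP => y; rewrite inE => yr.
apply: connect_trans (connect_tree_at xr) _.
by rewrite (sym_connect_sym (@adj_sym _)) connect_tree_at.
Qed.

Lemma acyclic_graphP E :
  acyclic_graph E <-> forall c : seq T, ucycle (adj E) c -> size c <= 2.
Proof.
split=> [/forallP acE c uc|acE].
  have szc : size c < #|T|.+1.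
    by case/andP: uc => _ /card_uniqP <-; rewrite ltnS max_card.
  by have /forallP/(_ (in_tuple c))/implyP := acE (Ordinal szc); apply.
by apply/forallP => m; apply/forallP => c; apply/implyP => /acE; rewrite size_tuple.
Qed.

Lemma acyclic_tree_at p r : parent_map p -> acyclic_graph (edges (tree_at p r)).
Proof.
move=> pm; apply/acyclic_graphP => c uc; rewrite leqNgt; apply/negP => c_gt2.
have [x0 x0c] : exists x0, x0 \in c.
  by case: c c_gt2 {uc} => // a c _; exists a; rewrite mem_head.
(* A vertex of maximal depth would have its parent as both its neighbours. *)
case: (@arg_maxnP _ x0 (mem c) (order p) x0c) => x xc maxx.
have [i s def_s] := rot_to xc.
have ucs : ucycle (adj (edges (tree_at p r))) (x :: s).
  by rewrite -def_s /ucycle rot_cycle rot_uniq.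
have xmax y : y \in x :: s -> y != x -> adj (edges (tree_at p r)) x y -> p x = y.
  move=> ys yx /adj_tree_at[]// py; have := maxx y.
  rewrite /= -(mem_rot i) def_s => /(_ ys); rewrite /= leqNgt -py.
  by rewrite order_parent // py eq_sym.
have : size (x :: s) > 2 by rewrite -def_s size_rot.
(* [a] and [b] are the successor and the predecessor of [x] on the cycle; length above 2 makes them
   distinct. *)
case: s def_s ucs xmax => // a s _; case/lastP: s => // s b.
rewrite /ucycle !cons_uniq !(inE, mem_rcons, negb_or) /= !rcons_path last_rcons.
case/andP=> /and3P[xa _ bx] /and3P[/and3P[x_a x_b _] /andP[a_b _] _] xmax _.
have := xmax a; rewrite !inE eqxx orbT eq_sym => /(_ isT x_a xa) pa.
have := xmax b; rewrite !inE mem_rcons inE eqxx !orbT eq_sym adj_sym => /(_ isT x_b bx).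
by rewrite pa => E; rewrite E eqxx in a_b.
Qed.

Lemma forest_of_is_labeled_forest p :
  parent_map p -> is_labeled_forest [set: T] (forest_of p).
Proof.
move=> pm; apply/and3P; split.
- apply/forall_inP => _ /imsetP[r + ->]; rewrite inE => /eqP pr.
  rewrite /is_rooted_tree /is_tree connected_tree_at acyclic_tree_at //= !andbT.
  have rV : r \in vertices (tree_at p r) by rewrite inE connect0.
  rewrite rV andbT; apply/andP; split; first by apply/set0Pn; exists r.
  apply/forall_inP => _ /imsetP[x + ->]; rewrite !inE => /andP[x_r xr].
  rewrite cards2 subUset !sub1set !inE fconnect_to_fixed // xr /= eq_sym.
  have [px|//] := eqVneq (p x) x.
  by move: x_r; rewrite (fconnect_fixed px xr) eqxx.
- apply/dinjectiveP => _ _ /imsetP[r + ->] /imsetP[s + ->].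
  rewrite !inE => /eqP pr /eqP ps /setP/(_ r); rewrite !inE connect0 => /esym rs.
  by rewrite (fconnect_fixed pr rs).
apply/and3P; split.
- apply/eqP/setP => x; rewrite inE; apply/bigcupP.
  have [r pr xr] := parent_map_root x pm.
  exists (vertices (tree_at p r)); last by rewrite inE.
  by apply/imset_f/imset_f; rewrite inE pr.
- apply/trivIsetP => _ _ /imsetP[_ /imsetP[r + ->] ->] /imsetP[_ /imsetP[s + ->] ->].
  rewrite !inE => /eqP pr /eqP ps; apply: contraR => /pred0Pn[x /andP[]].
  by rewrite /= !inE => xr xs; rewrite (fconnect_root_unique pr ps xr xs).
apply/imsetP => -[_ /imsetP[r _ ->]] /setP/(_ r).
by rewrite !inE connect0.
Qed.

(** Induction on depth. The edge [{x, p x}] also comes from [q], so either [q x = p x] or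
    [q (p x) = x]. In the second case induction at [p x] gives [p (p x) = x], against acyclicity. *)
Lemma forest_of_inj : {in [pred p | parent_map p] &, injective forest_of}.
Proof.
have tr_eq p q r : forest_of p = forest_of q -> p r = r -> tree_at p r = tree_at q r.
  move=> Epq pr; have : tree_at p r \in forest_of q.
    by rewrite -Epq imset_f // inE pr.
  by case/imsetP => s _ E; rewrite E; case: E => _ _ ->.
move=> p q; rewrite !inE => pm _ Epq; apply/ffunP => x.
have [n] := ubnP (order p x); elim: n => // n IHn in x *; rewrite ltnS => le_n.
have [r pr xr] := parent_map_root x pm; have Er := tr_eq _ _ _ Epq pr.
have [xr0|x_r] := eqVneq x r.
  rewrite xr0 pr; have : tree_at p r \in forest_of q by rewrite -Epq imset_f // inE pr.
  by case/imsetP => s; rewrite inE => /eqP qs [_ _ ->].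
have pxx : p x != x.
  by apply: contraNneq x_r => px; rewrite (fconnect_fixed px xr).
have : [set x; p x] \in edges (tree_at p r) by apply/imset_f; rewrite !inE x_r.
rewrite Er => /imsetP[z _ /set2_eq[[<- //]|[xqz pxz]]].
case/eqP: (pxx); apply: parent_map_acyclic => //.
have ppx : p (p x) = x.
  rewrite IHn; first by rewrite pxz -xqz.
  exact: leq_trans (order_parent pm pxx) le_n.
by rewrite -{2}ppx fconnect1.
Qed.

(** Breadth-first search: [d x] is the distance from [x] to [R], and every point outside [R] gets a
    parent at smaller distance. *)
Lemma exists_parent_map (e : rel T) (R : {set T}) :
    (forall x, exists2 r, r \in R & connect e x r) ->
  exists2 p, parent_map p & forall x, if x \in R then p x = x else e x (p x).
Proof.
move=> conR.
pose reach := fix reach n x :=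
  if n is n'.+1 then [exists y, e x y && reach n' y] else x \in R.
have ex_reach x : exists n, reach n x.
  have [r rR /connectP[s]] := conR x.
  elim: s x => [x _ /= <-|y s IHs x /= /andP[xy ys] lst]; first by exists 0.
  by have [n yn] := IHs y ys lst; exists n.+1; apply/existsP; exists y; rewrite xy.
pose d x := ex_minn (ex_reach x).
have dP x : reach (d x) x by rewrite /d; case: ex_minnP.
have d_min n x : reach n x -> d x <= n by rewrite /d; case: ex_minnP => m _; apply.
(* Outside [R] a shortest path provides such a [y], so the default [x] is never taken. *)
pose p := [ffun x => if x \in R then x else odflt x [pick y | e x y && (d y < d x)]].
have pP x : if x \in R then p x = x else e x (p x) && (d (p x) < d x).
  rewrite !ffunE; case: (boolP (x \in R)) => // xR; case: pickP => [y|none] //=.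
  have := dP x; case def_d: (d x) => [|n] /=; first by rewrite (negbTE xR).
  case/existsP=> y /andP[xy /d_min le_yn].
  by have := none y; rewrite xy def_d ltnS le_yn.
exists p => [|x]; last by have := pP x; case: ifP => // _ /andP[].
apply/parent_mapP => x; have [n] := ubnP (d x); elim: n => // n IHn in x *.
rewrite ltnS => le_n; have := pP x; case: ifP => [_ px|_ /andP[_ lt_px]].
  by exists 0.
by have [m pm] := IHn _ (leq_trans lt_px le_n); exists m.+1; rewrite iterSr.
Qed.

(** Searching from the roots inside the given trees yields [p]. Its trees have the same vertex sets
    and roots as those of [F], and their edges lie in those of [F]; acyclicity of [F] rules out
    further edges. *)
Lemma forest_of_surj F :
  is_labeled_forest [set: T] F -> exists2 p, parent_map p & F = forest_of p.
Proof.
case/and3P => /forall_inP treeF /dinjectiveP injF /and3P[/eqP covF /trivIsetP trF _].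
have treeV t x y : t \in F -> [set x; y] \in edges t ->
    [/\ x \in vertices t, y \in vertices t & x != y].
  move/treeF => /andP[/and4P[_ /forall_inP sim _ _] _] /sim.
  by rewrite subUset !sub1set cards2 => /andP[/andP[-> ->]]; case: (x != y).
have rootV t : t \in F -> root_of t \in vertices t by move/treeF => /andP[].
have tree_ex x : exists2 t, t \in F & x \in vertices t.
  have : x \in [set: T] by [].
  by rewrite -covF => /bigcupP[_ /imsetP[t tF ->] xt]; exists t.
have tree_uniq t t' x : t \in F -> t' \in F -> x \in vertices t ->
    x \in vertices t' -> t = t'.
  move=> tF t'F xt xt'; apply: injF => //; apply/eqP; apply: contraT => nV.
  have := trF _ _ (imset_f _ tF) (imset_f _ t'F) nV.
  by move/pred0P/(_ x); rewrite /= xt xt'.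
pose R := [set root_of t | t in F].
pose e x y := [exists t in F, [set x; y] \in edges t].
have rootR t x : t \in F -> x \in vertices t -> x \in R -> x = root_of t.
  move=> tF xt /imsetP[t' t'F Ex]; rewrite Ex; congr root_of.
  by apply: (tree_uniq _ _ x) => //; rewrite Ex rootV.
have eV t x y : t \in F -> x \in vertices t -> e x y ->
    y \in vertices t /\ [set x; y] \in edges t.
  move=> tF xt /exists_inP[t' t'F xy]; have [xt' yt' _] := treeV _ _ _ t'F xy.
  by rewrite (tree_uniq t t' x).
have [p pm pR] : exists2 p, parent_map p &
    forall x, if x \in R then p x = x else e x (p x).
  apply: exists_parent_map => x; have [t tF xt] := tree_ex x.
  exists (root_of t); first exact: imset_f.
  have /andP[/and4P[_ _ + _] _] := treeF _ tF.
  move=> /forall_inP/(_ _ xt)/forall_inP/(_ _ (rootV _ tF)).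
  by apply: connect_sub => y z yz; apply/connect1/exists_inP; exists t.
have fixR x : (p x == x) = (x \in R).
  have := pR x; case: ifP => [_ ->|_]; first by rewrite eqxx.
  by case/exists_inP => t tF /(treeV _ _ _ tF)[_ _]; rewrite eq_sym => /negbTE.
have pV t x : t \in F -> x \in vertices t -> p x \in vertices t.
  move=> tF xt; have := pR x; case: ifP => [_ ->//|_].
  by case/(eV _ _ _ tF xt).
(* Orbits never leave their tree, and each tree contains a single fixed point, its root. *)
have VE t x : t \in F -> fconnect p x (root_of t) = (x \in vertices t).
  move=> tF; have itV s y : s \in F -> y \in vertices s ->
      fconnect p y (root_of t) -> t = s.
    move=> sF ys /iter_findex yt.
    apply: (tree_uniq _ _ (root_of t)) => //; first exact: rootV.
    by rewrite -yt; elim: (findex _ _ _) => //= n IHn; apply: pV.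
  apply/idP/idP => [xt|xt]; first by have [s sF xs] := tree_ex x; rewrite (itV s x).
  have [r pr xr] := parent_map_root x pm.
  have rt : r \in vertices t.
    by rewrite -(iter_findex xr); elim: (findex _ _ _) => //= n IHn; apply: pV.
  by rewrite -(rootR t r) // -fixR pr.
have treeE t : t \in F -> tree_at p (root_of t) = t.
  move=> tF; have vE : vertices (tree_at p (root_of t)) = vertices t.
    by apply/setP => x; rewrite inE VE.
  have sE : edges (tree_at p (root_of t)) \subset edges t.
    apply/subsetP => _ /imsetP[x + ->]; rewrite !inE VE // => /andP[x_r xt].
    have := pR x; case: ifP => [xR|_ /(eV _ _ _ tF xt)[] //].
    by move: x_r; rewrite (rootR t x) ?eqxx.
  have eE : edges (tree_at p (root_of t)) = edges t.
    apply/eqP; rewrite eqEsubset sE /=; apply/subsetP => uv uvE.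
    have /andP[/and4P[_ /forall_inP sim _ /acyclic_graphP ac] _] := treeF _ tF.
    have /andP[_ /cards2P[u [v [u_v Euv]]]] := sim _ uvE.
    rewrite Euv in uvE *; have [ut vt _] := treeV _ _ _ tF uvE.
    have := connected_tree_at p (root_of t); rewrite vE.
    move=> /forall_inP/(_ _ ut)/forall_inP/(_ _ vt)/connectP[s0 s0P lst].
    (* A second path from u to v in t would close up to a cycle with uv. *)
    case/shortenP: s0P lst => s sP us _ lst.
    have := ac (u :: s); rewrite /ucycle us andbT /= rcons_path -lst.
    rewrite adj_sym [adj _ u v]uvE andbT (sub_path _ sP); last first.
      by move=> x y; apply: (subsetP sE).
    (* The bound 2 leaves at most one step in the path. No step would give [u = v]; a single step
       shows that [uv] is already an edge of [tree_at]. *)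
    move=> /(_ isT); case: s sP lst {us} => [_ vu|w [|//] /=].
      by rewrite vu eqxx in u_v.
    by rewrite andbT => uw ->.
  by case: t tF vE eE {sE} => [[V D] r] tF /= vE eE; rewrite /tree_at; congr (_, _, _).
exists p => //; apply/setP => t; apply/idP/imsetP => [tF|[r]].
  by exists (root_of t); rewrite ?treeE // inE fixR imset_f.
by rewrite inE fixR => /imsetP[t' t'F ->] ->; rewrite treeE.
Qed.

(** A root without children. *)
Definition isolated p x := [forall y, (p y == x) == (y == x)].

Lemma singleton_forest_of p x : is_singleton_tree_of (forest_of p) x = isolated p x.
Proof.
apply/exists_inP/forallP => [[_ /imsetP[r + ->] /eqP/setP V] y|isox].
  rewrite inE => /eqP pr; have := V r; rewrite !inE connect0 => /esym/eqP rx.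
  rewrite -rx; apply/eqP; apply/idP/idP => [/eqP pyr|/eqP ->]; last by rewrite pr.
  by have := V y; rewrite !inE -{1}pyr fconnect1 -rx => <-.
have px : p x = x by apply/eqP; rewrite (eqP (isox x)).
exists (tree_at p x); first by apply/imset_f; rewrite inE px.
apply/eqP/setP => y; rewrite !inE.
apply/idP/eqP => [/iter_findex|->]; last exact: connect0.
elim: (findex p y x) => //= n IHn pnx; apply: IHn.
by apply/eqP; rewrite -(eqP (isox _)) pnx.
Qed.

End ForestsOfParentMaps.

(** * Inclusion-exclusion over isolated points *)

Section Isolating.

Variable T : finType.
Implicit Types (p : {ffun T -> T}) (A B : {set T}).

(** Points outside [A] and [B] are unconstrained, which lets a point of [B] be released or moved to
    [A]. *)
Definition isolating A B : {set {ffun T -> T}} :=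
  [set p | [&& parent_map p, [forall x in A, isolated p x]
             & [forall x in B, ~~ isolated p x]]].

(** Isolated points carry no information; what remains is an arbitrary forest on the complement of
    [A]. *)
Lemma card_isolating0 A : #|isolating A set0| = tree_coef (#|T| - #|A|).
Proof.
rewrite -(cardsC A) addKn -card_parent_maps_on; apply: eq_card => p; rewrite !inE.
case: (parent_map p) => //=.
have -> : [forall x in set0, ~~ isolated p x] by apply/forall_inP => x; rewrite inE.
rewrite andbT; apply/forall_inP/forallP => [isoA x|pA x xA].
  rewrite !inE; case: (boolP (x \in A)) => xA /=.
    by have /forallP/(_ x) := isoA x xA; rewrite eqxx => /eqP.
  apply: contra xA => pxA; have /forallP/(_ x) := isoA _ pxA.
  by rewrite eqxx => /eqP/esym/eqP ->.
apply/forallP => y; apply/eqP; apply/eqP/eqP => [pyx|->].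
  by have := pA y; rewrite !inE pyx xA; case: ifP => //= _ /eqP ->.
by have := pA x; rewrite !inE xA => /eqP.
Qed.

(** Once released from [B], the point [x] is either not isolated or isolated. *)
Lemma card_isolatingU A B x : x \in B ->
  #|isolating A (B :\ x)| = #|isolating A B| + #|isolating (x |: A) (B :\ x)|.
Proof.
move=> xB; rewrite -(cardsID [set p | isolated p x]) addnC; congr (_ + _).
  apply: eq_card => p; rewrite !inE.
  case: (parent_map p); rewrite /= ?andbF //.
  case: [forall _ in A, _]; rewrite /= ?andbF //.
  apply/andP/forall_inP => [[xN /forall_inP BN] y yB|BN].
    by have [->//|yx] := eqVneq y x; rewrite BN // !inE yx.
  by split; [exact: BN | apply/forall_inP => y /setD1P[_]; exact: BN].
apply: eq_card => p; rewrite !inE.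
case: (parent_map p) => //=; case: [forall _ in B :\ x, _]; rewrite /= ?andbF // !andbT.
apply/andP/forall_inP => [[/forall_inP isoA isox] y /setU1P[->//|]|iso].
  exact: isoA.
by split; [apply/forall_inP => y yA; apply: iso; rewrite setU1r | rewrite iso ?setU11].
Qed.

End Isolating.

(** * Expressing [L] through parent maps *)

Local Open Scope ring_scope.

Lemma L_card_isolating (n : nat) (k : 'I_n.+1) :
  L k = #|isolating [set k] [set i : 'I_n.+1 | (k < i)%N]|.
Proof.
rewrite /L -(card_in_imset (f := @forest_of 'I_n.+1)); last first.
  by move=> p q; rewrite !inE => /andP[pm _] /andP[qm _]; apply: forest_of_inj.
apply: eq_card => F; rewrite inE; apply/and3P/imsetP.
  move=> [/forest_of_surj[p pm ->]]; rewrite singleton_forest_of => isok /forallP isoN.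
  exists p => //; rewrite inE pm /=; apply/andP; split.
    by apply/forall_inP => x /set1P ->.
  apply/forall_inP => x; rewrite inE => lt_kx; have := isoN x.
  by rewrite lt_kx singleton_forest_of.
move=> [p + ->]; rewrite inE => /and3P[pm /forall_inP isok /forall_inP isoN].
rewrite singleton_forest_of isok ?set11 //; split=> //.
  exact: forest_of_is_labeled_forest.
apply/forallP => i; apply/implyP => lt_ki; rewrite singleton_forest_of.
by rewrite isoN // inE.
Qed.

Lemma card_ord_gt (n : nat) (k : 'I_n.+1) :
  #|[set i : 'I_n.+1 | (k < i)%N]| = (n - k)%N.
Proof.
rewrite -sum1dep_card -(big_mkord (fun i => k < i)%N (fun=> 1%N)).
by rewrite -(big_nat_widenl k.+1 0 n.+1 xpredT) // sum_nat_const_nat muln1 subSS.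
Qed.

(** Trinomial revision. Writing [C(n-k, n-m)] instead of [C(n-k, m-k)] keeps it true for [m < k],
    where both sides vanish; truncated [m - k] would give 1 there. *)
Lemma mul_bin_trinomial (n m k : nat) : (k <= n)%N -> (m <= n)%N ->
  ('C(n, k) * 'C(n - k, n - m) = 'C(n, m) * 'C(m, k))%N.
Proof.
move=> le_kn le_mn; case: (leqP k m) => [le_km|lt_mk]; last first.
  by rewrite (bin_small lt_mk) muln0 (@bin_small (n - k)) ?muln0 //; lia.
have nk := bin_fact le_kn; have nm := bin_fact le_mn; have mk := bin_fact le_km.
have le_nmk : (n - m <= n - k)%N by lia.
have := bin_fact le_nmk; rewrite (_ : n - k - (n - m) = m - k)%N; last by lia.
move=> nmk; apply/eqP.
have pos : (0 < k`! * ((m - k)`! * (n - m)`!))%N by rewrite !muln_gt0 !fact_gt0.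
rewrite -(eqn_pmul2r pos); apply/eqP; transitivity n`!.
  by rewrite -nk -nmk; ring.
by rewrite -nm -mk; ring.
Qed.

(** * Binomial sums and the two identities *)

Section SumsOfL.

Variable R : comNzRingType.

Lemma sum_binomial_widen (m n : nat) (f : nat -> R) : (m <= n)%N ->
  \sum_(j < m.+1) 'C(m, j)%:R * f j = \sum_(j < n.+1) 'C(m, j)%:R * f j.
Proof.
move=> le_mn; rewrite (big_ord_widen n.+1 (fun j => 'C(m, j)%:R * f j)) //.
rewrite big_mkcond; apply: eq_bigr => j _; case: ltnP => // lt_mj.
by rewrite bin_small ?mul0r.
Qed.

Lemma sum_binomialS (m : nat) (f : nat -> R) :
  \sum_(j < m.+2) 'C(m.+1, j)%:R * f j
  = \sum_(j < m.+1) 'C(m, j)%:R * f j + \sum_(j < m.+1) 'C(m, j)%:R * f j.+1.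
Proof.
rewrite big_ord_recl (sum_binomial_widen f (leqnSn m)) [in RHS]big_ord_recl.
rewrite /= !bin0 -addrA; congr (_ + _); rewrite -big_split; apply: eq_bigr => j _.
by rewrite /bump /= add1n binS natrD mulrDl.
Qed.

(** Induction on [#|B|]: [card_isolatingU] is read as a difference, and the two resulting sums
    combine by Pascal's rule. *)
Lemma natr_card_isolating (T : finType) (A B : {set T}) : [disjoint A & B] ->
  #|isolating A B|%:R
  = \sum_(j < #|B|.+1) 'C(#|B|, j)%:R
      * ((-1) ^+ j * (tree_coef (#|T| - #|A| - j))%:R) :> R.
Proof.
move def_b: #|B| => b; elim: b => [|b IHb] in A B def_b * => dAB.
  rewrite (cards0_eq def_b) card_isolating0 big_ord1 bin0 subn0.
  by rewrite expr0 !mul1r.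
have [x xB] : exists x, x \in B by apply/set0Pn; rewrite -card_gt0 def_b.
have xA : x \notin A by rewrite (disjointFl dAB).
have cB : #|B :\ x| = b by move: def_b; rewrite (cardsD1 x) xB => -[].
have dA : [disjoint A & B :\ x] by apply: disjointWr dAB; apply: subsetDl.
have dxA : [disjoint x |: A & B :\ x].
  by rewrite -setI_eq0 setIUl setU_eq0 !setI_eq0 dA disjoints1 !inE eqxx.
have := card_isolatingU A xB => /(congr1 (GRing.natmul (1 : R)))/esym.
rewrite natrD => /(canRL (addrK _)) ->; rewrite (IHb _ _ cB dA) (IHb _ _ cB dxA).
rewrite (sum_binomialS _ (fun j => (-1) ^+ j * (tree_coef (#|T| - #|A| - j))%:R)).
rewrite -sumrN; congr (_ + _); apply: eq_bigr => j _.
(* Moving [x] into [A] shifts the index [j] by one, and the minus sign becomes the extra factor in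
   [(-1) ^+ j.+1]. *)
rewrite cardsU1 xA -!subnDA exprS (_ : (true + #|A| + j = #|A| + j.+1)%N); last by lia.
by ring.
Qed.

Lemma natr_L (n : nat) (k : 'I_n.+1) :
  (L k)%:R = \sum_(m < n.+1)
               'C(n - k, n - m)%:R * ((-1) ^+ (n - m) * (tree_coef m)%:R) :> R.
Proof.
rewrite L_card_isolating natr_card_isolating; last by rewrite disjoints1 inE ltnn.
rewrite card_ord_gt cards1 card_ord subn1 /=.
(* The upper limit is made independent of [k], as the later exchange of sums requires; then [j] is
   replaced by [n - m]. *)
rewrite (sum_binomial_widen (fun j => (-1) ^+ j * (tree_coef (n - j))%:R) (leq_subr k n)).
rewrite (reindex_inj rev_ord_inj) /=; apply: eq_bigr => m _.
by rewrite subSS subKn // -ltnS.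
Qed.

(** After exchanging the sums, trinomial revision extracts [C(n, m)], and the inner sum over [k] is
    the expansion of [(z + 1) ^+ m]. *)
Lemma sum_L (n : nat) (z : R) :
  \sum_(k < n.+1) 'C(n, k)%:R * (L k)%:R * z ^+ k
  = \sum_(m < n.+1) (-1) ^+ (n - m) * 'C(n, m)%:R * (tree_coef m)%:R * (z + 1) ^+ m.
Proof.
under eq_bigr => k _ do rewrite natr_L mulr_sumr mulr_suml.
rewrite exchange_big; apply: eq_bigr => m _ /=.
have le_mn : (m <= n)%N by rewrite -ltnS.
have -> : (z + 1) ^+ m = \sum_(k < n.+1) 'C(m, k)%:R * z ^+ k.
  rewrite -(sum_binomial_widen (fun k => z ^+ k) le_mn) addrC exprDn.
  by apply: eq_bigr => k _; rewrite expr1n mul1r mulr_natl.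
rewrite mulr_sumr; apply: eq_bigr => k _.
have le_kn : (k <= n)%N by rewrite -ltnS.
have := congr1 (GRing.natmul (1 : R)) (mul_bin_trinomial le_kn le_mn).
rewrite !natrM => E.
transitivity (('C(n, k)%:R * 'C(n - k, n - m)%:R) 
    * (-1) ^+ (n - m) * (tree_coef m)%:R * z ^+ k).
  by ring.
by rewrite E; ring.
Qed.

Lemma signrB (m n : nat) : (m <= n)%N ->
  (-1) ^+ (n - m) = (-1) ^+ n * (-1) ^+ m :> R.
Proof.
move=> le_mn; rewrite -[in RHS](subnK le_mn) exprD -mulrA -expr2.
by rewrite sqrr_sign mulr1.
Qed.

(** This is [sum_L] at [- (z + 1)], where the shifted argument becomes [- z]; the signs cancel in
    pairs. *)
Lemma sum_sign_L (n : nat) (z : R) :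
  \sum_(k < n.+1) (-1) ^+ (n - k) * 'C(n, k)%:R * (L k)%:R * (z + 1) ^+ k
  = \sum_(k < n.+1) 'C(n, k)%:R * (tree_coef k)%:R * z ^+ k.
Proof.
have sgn (k : 'I_n.+1) : (-1) ^+ (n - k) = (-1) ^+ n * (-1) ^+ k :> R.
  by rewrite signrB // -ltnS.
transitivity ((-1) ^+ n *
    \sum_(k < n.+1) 'C(n, k)%:R * (L k)%:R * (- (z + 1)) ^+ k).
  by rewrite mulr_sumr; apply: eq_bigr => k _; rewrite sgn (exprNn (z + 1)); ring.
rewrite sum_L mulr_sumr; apply: eq_bigr => k _.
rewrite sgn opprD addrNK (exprNn z).
have := sqrr_sign R n; have := sqrr_sign R k.
(* The signs become variables of square 1, so that [ring] only has to collect squares. *)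
move: ((-1) ^+ n) ((-1) ^+ k) => a b bb aa.
transitivity (a ^+ 2 * b ^+ 2 * ('C(n, k)%:R * (tree_coef k)%:R * z ^+ k)).
  by ring.
by rewrite aa bb !mul1r.
Qed.

End SumsOfL.

Theorem theorem5p2 (n : nat) :
  (\sum_(k < n.+1) (-1) ^+ (n - k) * ('C(n, k))%:R * (L k)%:R * ('X + 1) ^+ k
   = \sum_(k < n.+1) ('C(n, k))%:R * (tree_coef k)%:R * 'X ^+ k :> {poly int})
  /\
  (\sum_(k < n.+1) ('C(n, k))%:R * (L k)%:R * 'X ^+ k
   = \sum_(k < n.+1)
       (-1) ^+ (n - k) * ('C(n, k))%:R * (tree_coef k)%:R * ('X + 1) ^+ k
   :> {poly int}).
Proof. by split; [apply: sum_sign_L | apply: sum_L]. Qed.
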